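(* Consider the online asynchronous testing setting with conflict sets described in the context, and suppose that for every $t\in\mathcal{H}^0$ and every $u\in[0,1]$, $\mathbb{P}(P_t\le u\mid\mathcal{F}^{-\mathcal{X}^{E_t}})\le u$. Let $T$ be a random time with values in $\mathbb{N}$ such that (C1) $\{T=t\}\in\mathcal{F}^{-\mathcal{X}^{t+1}}$ for every $t$, and (C2) $T$ is almost surely bounded. Then any LORD* procedure and any SAFFRON* procedure with target level $\alpha$ (with $\mathcal{F}$ the LORD* filtration, respectively the SAFFRON* filtration) satisfy $\mathrm{mFDR}(T)\le\alpha$, where $\mathrm{mFDR}(T)=\mathbb{E}|\mathcal{V}(T)|/\mathbb{E}[|\mathcal{R}(T)|\vee1]$.
   Context: Hypotheses $H_1,H_2,\dots$ are tested; the test of $H_t$ starts at step $t$, is run at a test level $\alpha_t\ge 0$ (and, for SAFFRON*-type procedures, uses a candidacy threshold $\lambda_t$ with $\alpha_t\le\lambda_t<1$), and produces a $p$-value $P_t$. $\mathcal{H}^0\subseteq\mathbb{N}$ is the fixed (unknown) set of indices of true null hypotheses. Each test $t$ has a fixed (deterministic) decision time $E_t\in\mathbb{N}$ with $E_t\ge t$. Let $R_t=\mathbf{1}\{P_t\le\alpha_t\}$ and $C_t=\mathbf{1}\{P_t\le\lambda_t\}$. Let $\{L_t\}$ be a fixed sequence of nonnegative integer lags with $L_{t+1}\le L_t+1$. The conflict set of test $t$ is $\mathcal{X}^t=\{i\in[t-1]:E_i\ge t\}\cup\big(\{t-L_t,\dots,t-1\}\cap[t-1]\big)$. The non-conflicting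 $\sigma$-algebras are $\mathcal{L}^{-\mathcal{X}^t}=\sigma(R_i: i\le t-1,\ i\notin\mathcal{X}^t)$ (LORD* filtration) and $\mathcal{S}^{-\mathcal{X}^t}=\sigma(R_i,C_i: i\le t-1,\ i\notin\mathcal{X}^t)$ (SAFFRON* filtration); $\mathcal{F}^{-\mathcal{X}^t}$ denotes the relevant one. The set of rejections by time $t$ is $\mathcal{R}(t)=\{i\in[t]: E_i\le t,\ P_i\le\alpha_i\}$ and $\mathcal{V}(t)=\mathcal{R}(t)\cap\mathcal{H}^0$. A LORD* procedure is any rule choosing each $\alpha_t\ge0$ to be $\mathcal{L}^{-\mathcal{X}^t}$-measurable such that, for all $t\in\mathbb{N}$, $\sum_{j\le t}\alpha_j\le \alpha\big((\sum_{j<t,\,j\notin\mathcal{X}^t}R_j)\vee1\big)$. A SAFFRON* procedure is any rule choosing $\alpha_t,\lambda_t$ (with $0\le\alpha_t\le\lambda_t<1$) to be $\mathcal{S}^{-\mathcal{X}^t}$-measurable such that, for all $t\in\mathbb{N}$, $\sum_{j<t,\,j\notin\mathcal{X}^t}\frac{\alpha_j}{1-\lambda_j}\mathbf{1}\{P_j>\lambda_j\}+\sum_{j\in\mathcal{X}^t\cup\{t\}}\frac{\alpha_j}{1-\lambda_j}\le\alpha\big((\sum_{j<t,\,j\notin\mathcal{X}^t}R_j)\vee1\big)$. *)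

(* Defs.v *)
From mathcomp Require Import all_boot all_order all_algebra.
From mathcomp Require Import all_classical all_reals all_analysis.

Set Implicit Arguments.
Unset Strict Implicit.
Unset Printing Implicit Defensive.

Import Order.TTheory GRing.Theory Num.Theory.
Local Open Scope ring_scope.
Local Open Scope classical_set_scope.

Section OnlineTesting.
Context {Omega : Type} {R : realType}.

(* Tests are indexed by t = 1, 2, ...; index 0 is unused. *)

Definition inX (E L : nat -> nat) (t i : nat) : bool :=
  [&& (1 <= i)%N, (i < t)%N & ((t <= E i)%N || (t <= i + L t)%N)].

Definition inNC (E L : nat -> nat) (t i : nat) : bool :=
  [&& (1 <= i)%N, (i < t)%N & ~~ inX E L t i].

Definition ind_le (p a : nat -> Omega -> R) (i : nat) (w : Omega) : bool :=
  p i w <= a i w.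

(* observed information generating L^{-X^t}: (R_i)_{i <= t-1, i notin X^t} *)
Definition infoL (E L : nat -> nat) (p a : nat -> Omega -> R) (t : nat)
  (w : Omega) : nat -> bool :=
  fun i => inNC E L t i && ind_le p a i w.

(* observed information generating S^{-X^t}: (R_i, C_i)_{i <= t-1, i notin X^t} *)
Definition infoS (E L : nat -> nat) (p a lam : nat -> Omega -> R) (t : nat)
  (w : Omega) : nat -> bool * bool :=
  fun i => (inNC E L t i && ind_le p a i w, inNC E L t i && ind_le p lam i w).

(* A belongs to the sigma-algebra generated by the (finitely many,
   boolean) observed variables [info]. *)
Definition event_in {U : Type} (info : Omega -> U) (A : set Omega) : Prop :=
  exists g : U -> bool, A = [set w | g (info w)].

(* f is measurable w.r.t. the sigma-algebra generated by [info]. *)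
Definition rv_in {U : Type} (info : Omega -> U) (f : Omega -> R) : Prop :=
  exists g : U -> R, forall w, f w = g (info w).

Definition nNCRej (E L : nat -> nat) (p a : nat -> Omega -> R) (t : nat)
  (w : Omega) : nat :=
  (\sum_(1 <= j < t | inNC E L t j) ind_le p a j w)%N.

Definition nRej (E : nat -> nat) (p a : nat -> Omega -> R) (t : nat)
  (w : Omega) : nat :=
  (\sum_(1 <= i < t.+1) ((E i <= t)%N && ind_le p a i w))%N.

Definition nFalseRej (H0 : pred nat) (E : nat -> nat) (p a : nat -> Omega -> R)
  (t : nat) (w : Omega) : nat :=
  (\sum_(1 <= i < t.+1) [&& H0 i, (E i <= t)%N & ind_le p a i w])%N.

Definition LORDstar (alpha : R) (E L : nat -> nat) (p a : nat -> Omega -> R) : Prop :=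
  [/\ (forall t w, (1 <= t)%N -> 0 <= a t w),
      (forall t, (1 <= t)%N -> rv_in (infoL E L p a t) (a t)) &
      (forall t w, (1 <= t)%N ->
         \sum_(1 <= j < t.+1) a j w
           <= alpha * (maxn (nNCRej E L p a t w) 1)%:R)].

Definition SAFFRONstar (alpha : R) (E L : nat -> nat) (p a lam : nat -> Omega -> R)
  : Prop :=
  [/\ (forall t w, (1 <= t)%N -> 0 <= a t w /\ a t w <= lam t w /\ lam t w < 1),
      (forall t, (1 <= t)%N -> rv_in (infoS E L p a lam t) (a t)),
      (forall t, (1 <= t)%N -> rv_in (infoS E L p a lam t) (lam t)) &
      (forall t w, (1 <= t)%N ->
         \sum_(1 <= j < t | inNC E L t j)
             (a j w / (1 - lam j w)) * (nat_of_bool (lam j w < p j w)%R)%:R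
         + \sum_(1 <= j < t.+1 | inX E L t j || (j == t)) a j w / (1 - lam j w)
           <= alpha * (maxn (nNCRej E L p a t w) 1)%:R)].

End OnlineTesting.

Section MFDR.
Local Open Scope ereal_scope.
Context {d : measure_display} {Omega : measurableType d} {R : realType}.

(* conditional super-uniformity P(P_t <= u | G) <= u a.s., written out via
   the defining property of conditional probability: for every G-event A,
   P({P_t <= u} cap A) <= u P(A). *)
Definition cond_superuniform (P : probability Omega R) (pt : Omega -> R)
  (G : set Omega -> Prop) : Prop :=
  forall u : R, (0 <= u <= 1)%R ->
  forall A, G A -> P ([set w | (pt w <= u)%R] `&` A) <= u%:E * P A.

Definition mFDR (P : probability Omega R) (H0 : pred nat) (E : nat -> nat)
  (p a : nat -> Omega -> R) (T : Omega -> nat) : \bar R :=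
  (\int[P]_w ((nFalseRej H0 E p a (T w) w)%:R)%:E)
  / (\int[P]_w ((maxn (nRej E p a (T w) w) 1)%:R)%:E).

End MFDR.

(* Main.v *)
Require Import Defs.
From mathcomp Require Import all_boot all_order all_algebra.
From mathcomp Require Import all_classical all_reals all_analysis.
From mathcomp Require Import measurable_realfun zify.
Set Implicit Arguments.
Unset Strict Implicit.
Unset Printing Implicit Defensive.

Import Order.TTheory GRing.Theory Num.Theory.
Local Open Scope ring_scope.
Local Open Scope classical_set_scope.

(** Both procedures attach to test [i] a budget [b i >= 0]: [a i] for LORD*,
    and [a i / (1 - lam i)] on the event [p i > lam i] for SAFFRON*. Since the
    conflict sets give an increasing filtration and [E i <= T] is known at
    time [E i], conditional super-uniformity bounds the probability of a false
    rejection of [i] by time [T] by the expected budget of [i] on [E i <= T].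
    The wealth constraint, read at the random time [T], bounds the sum of the
    budgets of the decided tests by [alpha] times the number of
    non-conflicting rejections, all of which belong to [R(T)]. *)

(** * Generated sigma-algebras, seen as what factors through an information map *)

Section GeneratedEvents.
Context {Omega : Type} {R : realType} {U : Type}.
Implicit Types (info : Omega -> U) (A : set Omega).

Lemma event_in_setC info A : event_in info A -> event_in info (~` A).
Proof.
move=> [g ->]; exists (fun u => ~~ g u).
by apply/seteqP; split => w /=; [move/negP | move/negP].
Qed.

Lemma event_in_setU info A B :
  event_in info A -> event_in info B -> event_in info (A `|` B).
Proof.
move=> [g ->] [h ->]; exists (fun u => g u || h u).
by apply/seteqP; split => w /= /orP.
Qed.

Lemma event_in_preimage info (B : set U) : event_in info (info @^-1` B).
Proof.
by exists (fun u => `[< B u >]); apply/seteqP; split => w /= /asboolP.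
Qed.

(** Inclusion of sigma-algebras is expressed by factorization: the coarser [info] is a function
    [phi] of the finer [info']. *)
Lemma event_in_factor {V : Type} (info : Omega -> U) (info' : Omega -> V)
    (phi : V -> U) A :
  (forall w, info w = phi (info' w)) -> event_in info A -> event_in info' A.
Proof.
move=> infoE [g ->]; exists (g \o phi).
by apply/seteqP; split => w /=; rewrite infoE.
Qed.

Lemma rv_in_factor {V : Type} (info : Omega -> U) (info' : Omega -> V)
    (phi : V -> U) (f : Omega -> R) :
  (forall w, info w = phi (info' w)) -> rv_in info f -> rv_in info' f.
Proof. by move=> infoE [g fE]; exists (g \o phi) => w; rewrite fE infoE. Qed.

Lemma rv_in_comp2 info (h : R -> R -> R) (f g : Omega -> R) :
  rv_in info f -> rv_in info g -> rv_in info (fun w => h (f w) (g w)).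
Proof.
by move=> [f' fE] [g' gE]; exists (fun u => h (f' u) (g' u)) => w; rewrite fE gE.
Qed.

End GeneratedEvents.

(** Such a sequence is determined by its first [n] entries, and there are finitely many functions
    from ['I_n] to [B]. *)
Lemma finite_range_eventually_cst {Omega : Type} {B : finType} (b0 : B) (n : nat)
    (info : Omega -> nat -> B) :
  (forall w i, (n <= i)%N -> info w i = b0) -> finite_set (range info).
Proof.
move=> info0.
pose dec (f : {ffun 'I_n -> B}) i := if insub i is Some k then f k else b0.
apply: (@sub_finite_set _ _ (dec @` setT)); last first.
  exact/finite_image/finite_finset.
move=> _ [w _ <-]; exists [ffun k : 'I_n => info w k] => //.
apply/funext => i; rewrite /dec; case: insubP => [k _ <-|]; first by rewrite ffunE.
by rewrite -leqNgt => /info0 ->.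
Qed.

Lemma measurable_fiber_nat {d : measure_display} {Omega : measurableType d}
    {B : Type} (info : Omega -> nat -> B) :
  (forall i b, measurable [set w | info w i = b]) ->
  forall u, measurable (info @^-1` [set u]).
Proof.
move=> minfo u.
have -> : info @^-1` [set u] = \bigcap_i [set w | info w i = u i].
  apply/seteqP; split => w /=; first by move=> <-.
  by move=> infoE; apply/funext => i; exact: infoE.
exact: bigcapT_measurable.
Qed.

(** * Comparing integrals fibre by fibre when the information takes finitely many values *)

Section FiniteInformation.
Context {d : measure_display} {Omega : measurableType d} {R : realType}.
Context {U : choiceType} (info : Omega -> U).
Hypothesis fin_info : finite_set (range info).
Hypothesis meas_info : forall u, measurable (info @^-1` [set u]).

Let fin_image A : finite_set (info @` A).
Proof. by apply: sub_finite_set fin_info => _ [w _ <-]; exists w. Qed.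

Let event_fibers {A} : event_in info A ->
  A = \bigcup_(u in info @` A) (info @^-1` [set u]).
Proof.
move=> [g ->]; apply/seteqP; split => [w gw|w [_ [w' gw' <-] /= ->]//].
by exists (info w) => //; exists w.
Qed.

Lemma event_in_measurable A : event_in info A -> measurable A.
Proof. by move=> /event_fibers ->; apply: fin_bigcup_measurable. Qed.

Lemma rv_in_measurable (f : Omega -> R) : rv_in info f -> measurable_fun setT f.
Proof.
move=> [g fE] _ Y _; rewrite setTI; apply: event_in_measurable.
have -> : f @^-1` Y = info @^-1` (g @^-1` Y).
  by apply/seteqP; split => w /=; rewrite fE.
exact: event_in_preimage.
Qed.

Local Open Scope ereal_scope.

(** The fibres of [info] are the atoms of the generated sigma-algebra: an event is a finite disjoint
    union of them, and integrals add up over it. *)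
Lemma le_integral_fibers (mu : {measure set Omega -> \bar R})
    (f g : Omega -> \bar R) :
  measurable_fun setT f -> measurable_fun setT g ->
  (forall w, 0 <= f w) -> (forall w, 0 <= g w) ->
  (forall v, \int[mu]_(w in info @^-1` [set info v]) f w
             <= \int[mu]_(w in info @^-1` [set info v]) g w) ->
  forall A, event_in info A -> \int[mu]_(w in A) f w <= \int[mu]_(w in A) g w.
Proof.
move=> mf mg f0 g0 fg A infoA.
have mA := event_in_measurable infoA.
have tA (D : set U) : trivIset D (fun u => info @^-1` [set u]).
  by move=> u v _ _ [w [/= <- <-]].
have AE : A = \big[setU/set0]_(u <- finmap.enum_fset (fset_set (info @` A)))
    (info @^-1` [set u]).
  by rewrite bigsetU_fset_set //; exact: event_fibers.
rewrite AE !ge0_integral_bigsetU //.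
(* Only values attained on [A] are summed over, so each [u] has the form [info v] and the hypothesis
   on fibres applies. *)
- rewrite big_seq [leRHS]big_seq; apply: lee_sum => u.
  by rewrite in_fset_set// inE => -[v _ <-].
all: try exact: finmap.fset_uniq.
all: by rewrite -AE; exact: measurable_funTS.
Qed.

Let integral_fiber (mu : {measure set Omega -> \bar R}) (c : Omega -> R) v :
  rv_in info c ->
  \int[mu]_(w in info @^-1` [set info v]) (c w)%:E
    = (c v)%:E * mu (info @^-1` [set info v]).
Proof.
move=> [g cE]; rewrite (eq_integral (cst (c v)%:E)) ?integral_cst//.
by move=> w; rewrite inE /= => wv; rewrite !cE wv.
Qed.

Section Superuniform.
Context (P : probability Omega R) (q : Omega -> R).
Hypothesis mq : measurable_fun setT q.
Hypothesis su : cond_superuniform P q (event_in info).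

Let fiber_le (c : Omega -> R) v : rv_in info c ->
  [set w | (q w <= c w)%R] `&` info @^-1` [set info v]
  = [set w | (q w <= c v)%R] `&` info @^-1` [set info v].
Proof.
move=> [g cE].
by apply/seteqP; split => w /= [+ wv]; rewrite !cE wv; split.
Qed.

(** Super-uniformity concerns a fixed level, but on a fibre the random level [c] is constant, so it
    applies there with [u = c v]; the fibres are then summed. *)
Lemma prob_le_level (c : Omega -> R) A :
  rv_in info c -> (forall w, (0 <= c w)%R) -> event_in info A ->
  P ([set w | (q w <= c w)%R] `&` A) <= \int[P]_(w in A) (c w)%:E.
Proof.
move=> rc c0 infoA.
have mc := rv_in_measurable rc.
have mle : measurable [set w | (q w <= c w)%R].
  by rewrite -[X in measurable X]setTI; exact: measurable_fun_ler.
rewrite -integral_indic//; last exact: event_in_measurable infoA.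
move: A infoA; apply: le_integral_fibers => //.
- exact/measurable_EFinP/measurable_indic.
- exact/measurable_EFinP.
- move=> v; rewrite integral_indic// integral_fiber// fiber_le//.
  (* Super-uniformity is stated for levels in [[0,1]]; above 1 the mass of the whole fibre is
     already small enough. *)
  have [c1|c1] := leP (c v) 1%R.
    by apply: su; [rewrite c0 c1 | exact: event_in_preimage].
  apply: (@le_trans _ _ (P (info @^-1` [set info v]))).
    apply: le_measure; rewrite ?inE//; apply: measurableI => //.
    by rewrite -[X in measurable X]setTI; exact: measurable_fun_ler.
  by rewrite lee_pemull// lee_fin ltW.
Qed.

(* Given [info], the event [q > lam] has probability at least [1 - lam], so
   the weight [1 / (1 - lam)] on that event restores the lost mass. *)
Lemma integral_le_candidacy (c lam : Omega -> R) A :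
  rv_in info c -> (forall w, (0 <= c w)%R) ->
  rv_in info lam -> (forall w, (0 <= lam w < 1)%R) -> event_in info A ->
  \int[P]_(w in A) (c w)%:E
  <= \int[P]_(w in A)
       (c w / (1 - lam w) * (nat_of_bool (lam w < q w)%R)%:R)%:E.
Proof.
move=> rc c0 rlam lam01.
have rcl := rv_in_comp2 (fun x y => x / (1 - y))%R rc rlam.
have cl0 w : (0 <= c w / (1 - lam w))%R.
  by rewrite divr_ge0// subr_ge0 ltW//; case/andP: (lam01 w).
have mlt : measurable [set w | (lam w < q w)%R].
  rewrite -[X in measurable X]setTI; apply: measurable_fun_ltr => //.
  exact: rv_in_measurable.
have ltE w : ((nat_of_bool (lam w < q w))%:R = \1_[set w | lam w < q w] w :> R)%R.
  by rewrite indicE mem_setE.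
(* Super-uniformity at the level [lam v], complemented inside the fibre. *)
have fiber_mass v : (1 - lam v)%:E * P (info @^-1` [set info v])
    <= P ([set w | (lam w < q w)%R] `&` info @^-1` [set info v]).
  have mF := meas_info (info v).
  have [lam0 lam1] := andP (lam01 v).
  have := su (u := lam v) _ (event_in_preimage info [set info v]).
  rewrite lam0 (ltW lam1) -fiber_le// => /(_ isT).
  set F := info @^-1` _; set B := [set w | (q w <= lam w)%R].
  have -> : [set w | (lam w < q w)%R] = ~` B.
    by apply/seteqP; split => w /=; rewrite ltNge => /negP.
  have mB : measurable B.
    rewrite -[B]setTI; apply: measurable_fun_ler => //.
    exact: rv_in_measurable.
  rewrite (setIC B) (setIC (~` B)) -setDE.
  have -> : P (F `\` B) = P F - P (F `&` B).
    by apply: measureD => //; rewrite ltey_eq fin_num_measure.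
  have /fineK <- : P F \is a fin_num by exact: fin_num_measure.
  have /fineK <- : P (F `&` B) \is a fin_num.
    by apply: fin_num_measure; exact: measurableI.
  by rewrite -EFinB -!EFinM !lee_fin mulrBl mul1r lerD2l lerN2.
move: A; apply: le_integral_fibers => //.
- exact/measurable_EFinP/rv_in_measurable.
- apply/measurable_EFinP; apply: measurable_funM.
    exact: rv_in_measurable.
  rewrite (_ : (fun _ => _) = \1_[set w | (lam w < q w)%R]); last exact/funext.
  exact: measurable_indic.
- by move=> w; rewrite lee_fin mulr_ge0.
move=> v; rewrite integral_fiber//.
(* On the fibre the weight is the constant [k]; as [c v = k * (1 - lam v)], the claim is
   [fiber_mass] multiplied by [k]. *)
pose k := (c v / (1 - lam v))%R.
rewrite [leRHS](eq_integral
    (fun w => k%:E * (\1_[set w | (lam w < q w)%R] w)%:E)); last first.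
  have [g gE] := rcl.
  by move=> w; rewrite inE /= => wv; rewrite ltE EFinM /k !gE wv.
have mind : measurable_fun (info @^-1` [set info v])
    (EFin \o \1_[set w | (lam w < q w)%R] : Omega -> \bar R).
  exact/measurable_EFinP/measurable_indic.
have k0 : (0 <= k)%R := cl0 v.
rewrite ge0_integralZl_EFin//.
rewrite integral_indic//.
have -> : (c v = k * (1 - lam v))%R.
  by rewrite /k divfK// subr_eq0 eq_sym lt_eqF//; case/andP: (lam01 v).
by rewrite EFinM -muleA; apply: lee_wpmul2l => //; rewrite lee_fin.
Qed.
End Superuniform.
End FiniteInformation.

(** The events [T = t] form a countable measurable cover, and on each of them the function coincides
    with [f t]. *)
Lemma measurable_fun_nat_index {d d' : measure_display}
    {X : measurableType d} {Y : measurableType d'}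
    (T : X -> nat) (f : nat -> X -> Y) :
  (forall t, measurable [set w | T w = t]) ->
  (forall t, measurable_fun setT (f t)) ->
  measurable_fun setT (fun w => f (T w) w).
Proof.
move=> mT mf.
have -> : [set: X] = \bigcup_t [set w | T w = t].
  by apply/seteqP; split => // w _; exists (T w).
apply/measurable_fun_bigcup => // t.
apply: (eq_measurable_fun (f t)); last exact: measurable_funTS.
by move=> w; rewrite inE /= => ->.
Qed.

(** * Combinatorics of conflict sets and decision times *)

Section Counting.
Context {Omega : Type} {R : realType}.
Implicit Types (p a : nat -> Omega -> R) (E L : nat -> nat).

(** A decided test stays decided, and the lag condition prevents the left end [t - L t] of the lag
    window from moving backwards. *)
Lemma inNC_mono E L t t' i :
  (forall s, (1 <= s)%N -> (L s.+1 <= (L s).+1)%N) ->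
  (1 <= t <= t')%N -> inNC E L t i -> inNC E L t' i.
Proof.
move=> lagS /andP[t1 tt'].
elim: t' tt' => [|t' IH]; first by rewrite leqn0 => /eqP->.
rewrite leq_eqVlt => /predU1P[->//|tt' /(IH tt')].
have := lagS t' (leq_trans t1 tt'); rewrite /inNC /inX; lia.
Qed.

(** A test [i < t] outside the conflict set satisfies [E i < t], so its rejection is counted by time
    [t]. *)
Lemma nNCRej_le_nRej E L p a t w : (nNCRej E L p a t w <= nRej E p a t w)%N.
Proof.
rewrite /nNCRej /nRej (big_nat_widen _ _ t.+1)// big_mkcond /=.
apply: leq_sum => i _; case: ifP => // /andP[/and3P[i1 it]].
rewrite /inX i1 it /= negb_or -!ltnNge => /andP[Ei _] _.
by rewrite (ltnW Ei).
Qed.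

(** No test after [t] is decided by [t]. This allows the random upper limit [T w] to be replaced by
    a fixed bound, so that sum and integral can be exchanged. *)
Lemma sum_decided_widen (V : nmodType) E (F : nat -> V) t n :
  (forall i, (i <= E i)%N) -> (t <= n)%N ->
  \sum_(1 <= i < t.+1 | (E i <= t)%N) F i
  = \sum_(1 <= i < n.+1 | (E i <= t)%N) F i.
Proof.
move=> iE tn; rewrite (big_nat_widen _ _ n.+1)//; apply: eq_bigl => i.
by have := iE i; lia.
Qed.

(** Since [i <= E i <= t], either [i = t] or [i < t]. Hence the two sums of the SAFFRON* constraint
    together cover every decided test. *)
Lemma decided_conflict E L t i : (forall j, (j <= E j)%N) -> (1 <= i)%N ->
  (E i <= t)%N -> [|| inNC E L t i, inX E L t i | i == t].
Proof. by move=> /(_ i) iE; rewrite /inNC /inX; lia. Qed.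

End Counting.

(** * The budget argument at a random time, common to both procedures *)

Section Budget.
Context {d : measure_display} {Omega : measurableType d} {R : realType}.
Context (P : probability Omega R) (H0 : pred nat) (E : nat -> nat).
Context (p a b : nat -> Omega -> R) (alpha : R) (T : Omega -> nat).
Hypothesis iE : forall i, (i <= E i)%N.
Hypothesis mp : forall i, (1 <= i)%N -> measurable_fun setT (p i).
Hypothesis ma : forall i, (1 <= i)%N -> measurable_fun setT (a i).
Hypothesis mb : forall i, (1 <= i)%N -> measurable_fun setT (b i).
Hypothesis b0 : forall i w, (1 <= i)%N -> 0 <= b i w.
Hypothesis T1 : forall w, (1 <= T w)%N.
Hypothesis mT : forall t, measurable [set w | T w = t].
Hypothesis T_bounded : exists N : nat, {ae P, forall w, (T w <= N)%N}.
Hypothesis null_budget : forall i, (1 <= i)%N -> H0 i ->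
  (P ([set w | (p i w <= a i w)%R] `&` [set w | (E i <= T w)%N])
   <= \int[P]_(w in [set w | (E i <= T w)%N]) (b i w)%:E)%E.
Hypothesis wealth : forall t w, (1 <= t)%N ->
  \sum_(1 <= i < t.+1 | (E i <= t)%N) b i w
  <= alpha * (maxn (nRej E p a t w) 1)%:R.

(** The wealth constraint at time 1 has a nonnegative left side and a positive factor next to
    [alpha]; a sample point exists because [P] has total mass 1. *)
Let alpha_ge0 : 0 <= alpha.
Proof.
have [w _] : [set: Omega] !=set0.
  apply/set0P/eqP => Omega0; have := @probability_setT _ _ _ P.
  by rewrite Omega0 measure0 => /esym /eqP; rewrite onee_eq0.
have max_gt0 : 0 < (maxn (nRej E p a 1 w) 1)%:R :> R.
  by rewrite ltr0n leq_max orbT.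
rewrite -(pmulr_lge0 _ max_gt0); apply: le_trans (wealth w (leqnn 1)).
rewrite big_nat_cond; apply: sumr_ge0 => i /andP[/andP[i1 _] _].
exact: b0.
Qed.

Let mdecided i : measurable [set w | (E i <= T w)%N].
Proof.
have -> : [set w | (E i <= T w)%N] =
    \bigcup_(t in [set t | (E i <= t)%N]) [set w | T w = t].
  by apply/seteqP; split => w /=; [move=> EiT; exists (T w)|case=> t /= + ->].
exact: bigcup_measurable.
Qed.

Let mrej i : (1 <= i)%N -> measurable [set w | p i w <= a i w].
Proof.
by move=> i1; rewrite -[X in measurable X]setTI; apply: measurable_fun_ler; auto.
Qed.

Let mind i (B : bool) : (1 <= i)%N ->
  measurable_fun setT (fun w => (B && ind_le p a i w)%:R : R).
Proof.
move=> i1.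
rewrite (_ : (fun _ => _) = (fun w => B%:R * \1_[set w | p i w <= a i w] w)).
  by apply: measurable_funM => //; exact/measurable_indic/mrej.
apply/funext => w; rewrite indicE mem_setE /ind_le.
by case: B; rewrite ?mul1r ?mul0r.
Qed.

Let measurable_sum_index (n : nat) (f : nat -> Omega -> R) :
  (forall i, (1 <= i)%N -> measurable_fun setT (f i)) ->
  measurable_fun setT (fun w => \sum_(1 <= i < n) f i w).
Proof.
move=> mf; under eq_fun do rewrite big_add1.
by apply: measurable_sum => i; exact: mf.
Qed.

Let mV : measurable_fun setT (fun w => (nFalseRej H0 E p a (T w) w)%:R : R).
Proof.
apply: (measurable_fun_nat_index
  (f := fun t w => (nFalseRej H0 E p a t w)%:R : R)) => // t.
under eq_fun do rewrite /nFalseRej natr_sum.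
apply: measurable_sum_index => // i i1.
by under eq_fun do rewrite andbA; exact: mind.
Qed.

Let mR : measurable_fun setT (fun w => (maxn (nRej E p a (T w) w) 1)%:R : R).
Proof.
apply: (measurable_fun_nat_index
  (f := fun t w => (maxn (nRej E p a t w) 1)%:R : R)) => // t.
rewrite (_ : (fun _ => _) = (fun w => Num.max (nRej E p a t w)%:R 1 : R)).
  apply: measurable_maxr => //.
  under eq_fun do rewrite /nRej natr_sum.
  by apply: measurable_sum_index => // i i1; exact: mind.
by apply/funext => w; rewrite natr_max.
Qed.

Local Open Scope ereal_scope.

(** Three comparisons: false rejections become a fixed finite sum of indicators, each indicator is
    exchanged for its budget by [null_budget], and the budgets are bounded by the wealth constraint.
    The outer two hold pointwise where [T <= N]. *)
Lemma integral_nFalseRej_le :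
  \int[P]_w ((nFalseRej H0 E p a (T w) w)%:R)%:E
  <= alpha%:E * \int[P]_w ((maxn (nRej E p a (T w) w) 1)%:R)%:E.
Proof.
have [N TN] := T_bounded.
pose D i := [set w | (E i <= T w)%N].
pose A i := [set w | (p i w <= a i w)%R] `&` D i.
have mA i : (1 <= i)%N -> measurable (A i).
  by move=> i1; apply: measurableI; [exact: mrej|exact: mdecided].
have memA i w : (w \in A i) = ind_le p a i w && (E i <= T w)%N.
  by apply/idP/andP; rewrite inE.
(* Sums start at 0 from here on, so index [i] stands for test [i + 1]. *)
pose f i w : \bar R := if H0 i.+1 then (\1_(A i.+1) w)%:E else 0.
pose g i : Omega -> \bar R := (EFin \o b i.+1) \_ (D i.+1).
have f0 i w : 0 <= f i w by rewrite /f; case: ifP.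
have mf i : measurable_fun setT (f i).
  rewrite /f; case: (H0 i.+1) => //.
  exact/measurable_EFinP/measurable_indic/mA.
have g0 i w : 0 <= g i w.
  by rewrite /g patchE; case: ifP => // _; rewrite lee_fin b0.
have mg i : measurable_fun setT (g i).
  apply/measurable_restrict => //; first exact: mdecided.
  by apply: measurable_funTS; exact/measurable_EFinP/mb.
apply: (@le_trans _ _ (\int[P]_w \sum_(0 <= i < N) f i w)).
  apply: ae_ge0_le_integral => //.
  - exact/measurable_EFinP.
  - by move=> w _; apply: sume_ge0.
  - exact: emeasurable_sum.
  - apply: filterS TN => w TwN _.
    rewrite (_ : \sum_(0 <= i < N) _ = (nFalseRej H0 E p a (T w) w)%:R%:E)//.
    have -> : nFalseRej H0 E p a (T w) w =
        (\sum_(1 <= i < (T w).+1 | (E i <= T w)%N) (H0 i && ind_le p a i w))%N.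
      rewrite [RHS]big_mkcond; apply: eq_bigr => i _.
      by case: (H0 i); case: (E i <= T w)%N.
    rewrite (sum_decided_widen _ iE TwN) natr_sum -sumEFin big_add1 [RHS]big_mkcond.
    apply: eq_bigr => i _; rewrite /f indicE memA.
    by case: (H0 _); case: (E _ <= _)%N; rewrite ?andbT ?andbF.
apply: (@le_trans _ _ (\int[P]_w \sum_(0 <= i < N) g i w)).
  rewrite !ge0_integral_sum//; apply: lee_sum => i _.
  rewrite /g -integral_mkcond /f; have [H0i|_] := boolP (H0 i.+1); last first.
    by rewrite integral0; apply: integral_ge0 => w _; rewrite lee_fin b0.
  by rewrite integral_indic ?setIT//; [exact: null_budget|exact: mA].
rewrite -ge0_integralZl_EFin//; last exact/measurable_EFinP.
apply: ae_ge0_le_integral => //.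
- by move=> w _; apply: sume_ge0.
- exact: emeasurable_sum.
- by move=> w _; rewrite -EFinM lee_fin mulr_ge0.
- by apply: measurable_funeM; exact/measurable_EFinP.
(* Cutting each budget to [D i] turns the sum up to [N] into the sum over tests decided by [T w],
   where the wealth constraint is read at time [T w]. *)
apply: filterS TN => w TwN _.
rewrite -EFinM (_ : \sum_(0 <= i < N) _ =
    (\sum_(1 <= i < (T w).+1 | (E i <= T w)%N) b i w)%:E).
  by rewrite lee_fin; exact: wealth.
rewrite (sum_decided_widen _ iE TwN) -sumEFin big_add1 [RHS]big_mkcond.
by apply: eq_bigr => i _; rewrite /g patchE mem_setE.
Qed.

Lemma mFDR_le : mFDR P H0 E p a T <= alpha%:E.
Proof.
rewrite /mFDR; have := integral_nFalseRej_le.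
set V := \int[P]_w _; set M := \int[P]_w _ => VM.
have M1 : 1 <= M.
  rewrite -(@probability_setT _ _ _ P) -[leLHS]mul1e -integral_cst//.
  apply: ge0_le_integral => //; first exact/measurable_EFinP.
  by move=> w _; rewrite lee_fin ler1n leq_max orbT.
(* For an infinite denominator the quotient is 0, since the inverse of [+oo] is 0, and [alpha_ge0]
   concludes. *)
move: M1 VM; case: M => [r| |]//; last by rewrite invey mule0 lee_fin.
rewrite lee_fin => r1 Vr; have r0 : (0 < r)%R by exact: lt_le_trans r1.
by rewrite inver gt_eqF// lee_pdivrMr.
Qed.

End Budget.

(** * Growth of the non-conflicting information and its events about the random time *)

Lemma infoL_factor {Omega : Type} {R : realType} (E L : nat -> nat)
    (p a : nat -> Omega -> R) t t' :
  (forall s, (1 <= s)%N -> (L s.+1 <= (L s).+1)%N) -> (1 <= t <= t')%N ->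
  exists phi, forall w, infoL E L p a t w = phi (infoL E L p a t' w).
Proof.
move=> lagS tt'; exists (fun u i => inNC E L t i && u i) => w.
apply/funext => i; rewrite /infoL andbA; congr (_ && _).
by case: (boolP (inNC _ _ t i)) => // /(inNC_mono lagS tt') ->.
Qed.

Lemma infoS_factor {Omega : Type} {R : realType} (E L : nat -> nat)
    (p a lam : nat -> Omega -> R) t t' :
  (forall s, (1 <= s)%N -> (L s.+1 <= (L s).+1)%N) -> (1 <= t <= t')%N ->
  exists phi, forall w, infoS E L p a lam t w = phi (infoS E L p a lam t' w).
Proof.
move=> lagS tt'.
exists (fun u i => (inNC E L t i && (u i).1, inNC E L t i && (u i).2)) => w.
apply/funext => i; rewrite /infoS /=.
by case: (boolP (inNC _ _ t i)) => // /(inNC_mono lagS tt') ->.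
Qed.

(** The complement [T < n] is the union of the events [T = m] with [m < n], each known from
    [info (m + 1)] and hence from [info n]. With [n = E i], whether test [i] is decided by [T] is
    known at time [E i]. *)
Lemma event_in_decided {Omega : Type} {V : Type} (info : nat -> Omega -> V)
    (T : Omega -> nat) :
  (forall t t', (1 <= t <= t')%N ->
     exists phi, forall w, info t w = phi (info t' w)) ->
  (forall t, event_in (info t.+1) [set w | T w = t]) ->
  forall n, event_in (info n) [set w | (n <= T w)%N].
Proof.
move=> filt infoT n.
have T_lt m : (m <= n)%N -> event_in (info n) [set w | (T w < m)%N].
  elim: m => [_|m IH mn]; first by exists xpred0; apply/seteqP; split.
  rewrite (_ : [set w | _] = [set w | (T w < m)%N] `|` [set w | T w = m]).
    apply: event_in_setU; first exact/IH/ltnW.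
    by have [phi infoE] := filt m.+1 n mn; exact: event_in_factor infoE (infoT m).
  apply/seteqP; split => w /=; first by rewrite ltnS leq_eqVlt => /predU1P; tauto.
  by case=> [/ltnW//|->].
rewrite (_ : [set w | _] = ~` [set w | (T w < n)%N]).
  exact/event_in_setC/T_lt.
apply/seteqP; split => w /=; first by rewrite leqNgt => /negP.
by move=> /negP; rewrite -leqNgt.
Qed.

(** * Finiteness and measurability of the observed information *)

Section ObservedInformation.
Context {d : measure_display} {Omega : measurableType d} {R : realType}.
Context (E L : nat -> nat) (p a lam : nat -> Omega -> R).
Hypothesis mp : forall i, (1 <= i)%N -> measurable_fun setT (p i).
Hypothesis ma : forall i, (1 <= i)%N -> measurable_fun setT (a i).

Let measurable_ind (q c : nat -> Omega -> R) t i b :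
  (forall i, (1 <= i)%N -> measurable_fun setT (q i)) ->
  (forall i, (1 <= i)%N -> measurable_fun setT (c i)) ->
  measurable [set w | inNC E L t i && ind_le q c i w = b].
Proof.
(* Outside the non-conflicting indices the coordinate is constantly [false], so the set is
   everything or empty. *)
move=> mq mc; have [/= tNC|tNC] := boolP (inNC E L t i); last first.
  have [<-|bF] := pselect (false = b).
    by rewrite (_ : [set _ | _] = setT)//; apply/seteqP; split.
  by rewrite (_ : [set _ | _] = set0)//; apply/seteqP; split.
have i1 : (1 <= i)%N by case/and3P: tNC.
rewrite -[X in measurable X]setTI.
exact: (measurable_fun_ler (mq _ i1) (mc _ i1) measurableT (Y := [set b])).
Qed.

Lemma finite_range_infoL t : finite_set (range (infoL E L p a t)).
Proof.
apply: (@finite_range_eventually_cst _ _ false t) => w i ti.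
by rewrite /infoL /inNC (ltnNge i) ti andbF.
Qed.

Lemma finite_range_infoS t : finite_set (range (infoS E L p a lam t)).
Proof.
apply: (@finite_range_eventually_cst _ _ (false, false) t) => w i ti.
by rewrite /infoS /inNC (ltnNge i) ti andbF.
Qed.

Lemma measurable_fiber_infoL t u : measurable (infoL E L p a t @^-1` [set u]).
Proof. by apply: measurable_fiber_nat => i b; exact: measurable_ind. Qed.

Lemma measurable_fiber_infoS t u :
  (forall i, (1 <= i)%N -> measurable_fun setT (lam i)) ->
  measurable (infoS E L p a lam t @^-1` [set u]).
Proof.
move=> mlam; apply: measurable_fiber_nat => i [b c].
rewrite (_ : [set w | _] = [set w | inNC E L t i && ind_le p a i w = b] `&`
                          [set w | inNC E L t i && ind_le p lam i w = c]).
  by apply: measurableI; exact: measurable_ind.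
by apply/seteqP; split => w /=; rewrite /infoS; [case=> -> -> | case=> <- <-].
Qed.

End ObservedInformation.

(** * The two procedures as instances of the budget argument *)

Section Procedures.
Context {d : measure_display} {Omega : measurableType d} {R : realType}.
Context (P : probability Omega R) (H0 : pred nat) (E L : nat -> nat).
Context (p : nat -> Omega -> R) (alpha : R) (T : Omega -> nat).
Hypothesis iE : forall t, (t <= E t)%N.
Hypothesis lagS : forall t, (1 <= t)%N -> (L t.+1 <= (L t).+1)%N.
Hypothesis mp : forall t, (1 <= t)%N -> measurable_fun setT (p t).
Hypothesis T1 : forall w, (1 <= T w)%N.
Hypothesis T_bounded : exists N : nat, {ae P, forall w, (T w <= N)%N}.

(** Enlarging the rejection count preserves the bound because [alpha >= 0], which the two
    inequalities on [x] imply. *)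
Let le_alpha_nRej (a : nat -> Omega -> R) t w x :
  0 <= x -> x <= alpha * (maxn (nNCRej E L p a t w) 1)%:R ->
  x <= alpha * (maxn (nRej E p a t w) 1)%:R.
Proof.
move=> x0 xle; apply: (le_trans xle); apply: ler_wpM2l.
  have max_gt0 : 0 < (maxn (nNCRej E L p a t w) 1)%:R :> R.
    by rewrite ltr0n leq_max orbT.
  by rewrite -(pmulr_lge0 _ max_gt0) (le_trans x0 xle).
by rewrite ler_nat geq_max !leq_max nNCRej_le_nRej leqnn orbT.
Qed.

(** The level is its own budget: [a i] is known at time [i], hence at [E i], where super-uniformity
    is available. *)
Lemma LORDstar_mFDR_le (a : nat -> Omega -> R) :
  LORDstar alpha E L p a ->
  (forall t, (1 <= t)%N -> measurable_fun setT (a t)) ->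
  (forall t, (1 <= t)%N -> H0 t ->
     cond_superuniform P (p t) (event_in (infoL E L p a (E t)))) ->
  (forall t, event_in (infoL E L p a t.+1) [set w | T w = t]) ->
  (mFDR P H0 E p a T <= alpha%:E)%E.
Proof.
move=> [a0 ra sum_a] ma su infoT.
have fin := finite_range_infoL E L p a.
have mfib := measurable_fiber_infoL E L mp ma.
have decided := event_in_decided (fun t t' => infoL_factor E p a lagS) infoT.
apply: (mFDR_le (b := a)) => //.
- by move=> t; exact: event_in_measurable (fin _) (mfib _) _ (infoT t).
- move=> i i1 H0i; have iEi : (1 <= i <= E i)%N by rewrite i1 iE.
  have [phi phiE] := infoL_factor E p a lagS iEi.
  exact: (prob_le_level (fin _) (mfib _) (mp i1) (su _ i1 H0i)
    (rv_in_factor phiE (ra _ i1)) (fun w => a0 i w i1) (decided _)).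
move=> t w t1; apply: le_alpha_nRej.
  by rewrite big_nat_cond; apply: sumr_ge0 => i /andP[/andP[i1 _] _]; exact: a0.
apply: le_trans (sum_a t w t1).
rewrite big_mkcond big_nat [leRHS]big_nat; apply: ler_sum => i /andP[i1 _].
by case: ifP => // _; exact: a0.
Qed.

Lemma SAFFRONstar_mFDR_le (a lam : nat -> Omega -> R) :
  SAFFRONstar alpha E L p a lam ->
  (forall t, (1 <= t)%N -> measurable_fun setT (a t)) ->
  (forall t, (1 <= t)%N -> measurable_fun setT (lam t)) ->
  (forall t, (1 <= t)%N -> H0 t ->
     cond_superuniform P (p t) (event_in (infoS E L p a lam (E t)))) ->
  (forall t, event_in (infoS E L p a lam t.+1) [set w | T w = t]) ->
  (mFDR P H0 E p a T <= alpha%:E)%E.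
Proof.
move=> [a_lam ra rlam sum_a] ma mlam su infoT.
have fin := finite_range_infoS E L p a lam.
have mfib t u := measurable_fiber_infoS E L mp ma t u mlam.
have decided := event_in_decided (fun t t' => infoS_factor E p a lam lagS) infoT.
have a0 i w : (1 <= i)%N -> 0 <= a i w by case/(a_lam i w).
have lam01 i w : (1 <= i)%N -> 0 <= lam i w < 1.
  by case/(a_lam i w) => a0' [al ->]; rewrite (le_trans a0' al).
have w0 i w : (1 <= i)%N -> 0 <= a i w / (1 - lam i w).
  move=> i1; apply: divr_ge0; first exact: a0.
  by case/andP: (lam01 i w i1) => _ /ltW; rewrite subr_ge0.
pose b i w := a i w / (1 - lam i w) * (nat_of_bool (lam i w < p i w))%:R.
have b0 i w : (1 <= i)%N -> 0 <= b i w by move=> i1; rewrite mulr_ge0 ?w0.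
have b_le i w : (1 <= i)%N -> b i w <= a i w / (1 - lam i w).
  by move=> i1; rewrite ler_piMr ?w0// lern1 leq_b1.
apply: (mFDR_le (b := b)) => //.
- move=> i i1; apply: measurable_funM.
    apply: (rv_in_measurable (fin i) (mfib i)).
    exact: (rv_in_comp2 (fun x y => x / (1 - y)) (ra _ i1) (rlam _ i1)).
  rewrite (_ : (fun _ => _) = \1_[set w | lam i w < p i w]).
    apply: measurable_indic; rewrite -[X in measurable X]setTI.
    by apply: measurable_fun_ltr; auto.
  by apply/funext => w; rewrite indicE mem_setE.
- by move=> t; exact: event_in_measurable (fin _) (mfib _) _ (infoT t).
- move=> i i1 H0i; have iEi : (1 <= i <= E i)%N by rewrite i1 iE.
  have [phi phiE] := infoS_factor E p a lam lagS iEi.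
  have raE := rv_in_factor phiE (ra _ i1).
  have rlamE := rv_in_factor phiE (rlam _ i1).
  (* Super-uniformity serves twice: at level [a i] it bounds the rejection probability, at level
     [lam i] it replaces [a i] by the budget [b i]. *)
  apply: (@le_trans _ _ (\int[P]_(w in [set w | (E i <= T w)%N]) (a i w)%:E)%E).
    exact: (prob_le_level (fin _) (mfib _) (mp i1) (su _ i1 H0i) raE
      (fun w => a0 i w i1) (decided _)).
  exact: (integral_le_candidacy (fin _) (mfib _) (mp i1) (su _ i1 H0i) raE
    (fun w => a0 i w i1) rlamE (fun w => lam01 i w i1) (decided _)).
move=> t w t1; apply: le_alpha_nRej.
  by rewrite big_nat_cond; apply: sumr_ge0 => i /andP[/andP[i1 _] _]; exact: b0.
apply: le_trans (sum_a t w t1).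
(* All three sums are put on the range up to [t], so that they can be compared term by term. *)
rewrite [X in _ <= X + _](big_nat_widen _ _ t.+1)// big_mkcond.
rewrite [X in _ <= X + _]big_mkcond [X in _ <= _ + X]big_mkcond -big_split /=.
rewrite big_nat [leRHS]big_nat; apply: ler_sum => i /andP[i1 it].
case: ifP => [Ei|_]; last first.
  by apply: addr_ge0; case: ifP => // _; [exact: b0|exact: w0].
(* A non-conflicting test contributes exactly [b i] to the first sum; any other decided test
   contributes its full weight, at least [b i], to the second. *)
have [NC|nNC] := boolP (inNC E L t i).
  have -> : (i < t)%N by case/and3P: NC.
  by rewrite lerDl; case: ifP => // _; exact: w0.
have := decided_conflict L iE i1 Ei; rewrite (negbTE nNC) /= => ->.
by rewrite add0r b_le.
Qed.

End Procedures.

Theorem theorem2 (d : measure_display) (Omega : measurableType d) (R : realType)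
  (P : probability Omega R) (H0 : pred nat) (E L : nat -> nat)
  (p : nat -> Omega -> R) (alpha : R) :
  (forall t, (t <= E t)%N) ->
  (forall t, (1 <= t)%N -> (L t.+1 <= (L t).+1)%N) ->
  (forall t, (1 <= t)%N -> measurable_fun setT (p t)) ->
  (* LORD* *)
  (forall (a : nat -> Omega -> R) (T : Omega -> nat),
     LORDstar alpha E L p a ->
     (forall t, (1 <= t)%N -> measurable_fun setT (a t)) ->
     (forall t, (1 <= t)%N -> H0 t ->
        cond_superuniform P (p t) (event_in (infoL E L p a (E t)))) ->
     (forall w, (1 <= T w)%N) ->
     (forall t, event_in (infoL E L p a t.+1) [set w | T w = t]) ->
     (exists N : nat, {ae P, forall w, (T w <= N)%N}) ->
     (mFDR P H0 E p a T <= alpha%:E)%E)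
  /\
  (* SAFFRON* *)
  (forall (a lam : nat -> Omega -> R) (T : Omega -> nat),
     SAFFRONstar alpha E L p a lam ->
     (forall t, (1 <= t)%N -> measurable_fun setT (a t)) ->
     (forall t, (1 <= t)%N -> measurable_fun setT (lam t)) ->
     (forall t, (1 <= t)%N -> H0 t ->
        cond_superuniform P (p t) (event_in (infoS E L p a lam (E t)))) ->
     (forall w, (1 <= T w)%N) ->
     (forall t, event_in (infoS E L p a lam t.+1) [set w | T w = t]) ->
     (exists N : nat, {ae P, forall w, (T w <= N)%N}) ->
     (mFDR P H0 E p a T <= alpha%:E)%E).
Proof.
move=> iE lagS mp; split.
  move=> a T lord ma su T1 infoT T_bounded.
  exact: (LORDstar_mFDR_le iE lagS mp T1 T_bounded lord ma su infoT).
move=> a lam T saffron ma mlam su T1 infoT T_bounded.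
exact: (SAFFRONstar_mFDR_le iE lagS mp T1 T_bounded saffron ma mlam su infoT).
Qed.
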